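(* Let $\mathcal F=\{f_i(x)=r_ix+b_i\}_{i=1}^m$ be an affine reverse iterated function system on $\mathbb R$, with $r_i,b_i\in\mathbb R$ and $|r_i|>1$ for all $i$, and let $K$ be an invariant set of $\mathcal F$. Then $$\dim_{\mathrm M}K=\begin{cases}d_{\mathcal F},&\text{if }K\text{ is locally finite},\\\infty,&\text{otherwise},\end{cases}$$ and $$\dim_{\mathrm{Be}}K=\begin{cases}d_{\mathcal F}\le1,&\text{if }K\text{ is uniformly locally finite},\\\infty,&\text{otherwise}.\end{cases}$$ (In the first case of the last formula, the inequality $d_{\mathcal F}\le1$ is part of the assertion.)
   Context: The maps $f_1,\dots,f_m$ are distinct. An invariant set of $\mathcal F$ is a nonempty set $K\subseteq\mathbb R$ with $K=\bigcup_{i=1}^mf_i(K)$. $G^*(\mathcal F)$ is the semigroup of distinct maps generated by $\mathcal F$ under composition (all nonempty finite compositions), $|g'|$ is the absolute value of the linear coefficient of the affine map $g$, and $d_{\mathcal F}=\lim_{R\to\infty}\log\#\{g\in G^*(\mathcal F):|g'|\le R\}/\log R$ (this limit always exists). A set $E\subseteq\mathbb R$ is locally finite if its intersection with every bounded set is finite, and uniformly locally finite if $\sup_{x\in\mathbb R}\#(E\cap[x-R,x+R])<\infty$ for every $R>0$. For $\alpha>0$ let $\mathcal C_\alpha^\pm(E)$ be the $\limsup$ ($+$) and $\liminf$ ($-$) as $h\to\infty$ of $\#(E\cap[-h,h])/h^\alpha$; the upper and lower mass dimensions are $\inf\{\alpha\ge0:\mathcal C_\alpha^{\pm}(E)<\infty\}$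 (with $\inf\varnothing=\infty$), and if they coincide the common value is $\dim_{\mathrm M}E$. The Beurling dimension is $\dim_{\mathrm{Be}}E=\inf\{\alpha>0:\mathcal D_\alpha^+(E)<\infty\}$ (with $\inf\varnothing=\infty$), where $\mathcal D_\alpha^+(E)=\limsup_{h\to\infty}\sup_{x\in\mathbb R}\#(E\cap[x-h,x+h])/h^\alpha$. *)

(* Defs.v *)
From mathcomp Require Import all_boot all_order all_algebra.
From mathcomp Require Import finmap.
From mathcomp Require Import all_classical all_reals all_analysis.
Set Implicit Arguments.
Unset Strict Implicit.
Unset Printing Implicit Defensive.
Import Order.TTheory GRing.Theory Num.Theory.
Import numFieldNormedType.Exports.
Local Open Scope classical_set_scope.
Local Open Scope ring_scope.

Definition affmap (R : realType) (a b : R) : R -> R := fun x => a * x + b.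

Definition invariant_set (R : realType) (m : nat) (f : 'I_m -> R -> R)
    (K : set R) : Prop :=
  K !=set0 /\ K = \bigcup_(i in [set: 'I_m]) (f i @` K).

Definition word_map (R : realType) (m : nat) (f : 'I_m -> R -> R)
    (w : seq 'I_m) : R -> R :=
  foldr (fun i g => f i \o g) id w.

(* The elements are maps, not words: compositions that agree as maps are
   counted once. *)
Definition semigroup (R : realType) (m : nat) (f : 'I_m -> R -> R) :
    set (R -> R) :=
  [set g | exists2 w : seq 'I_m, w != [::] & g = word_map f w].

Definition slope_le (R : realType) (rho : R) : set (R -> R) :=
  [set g | exists a b : R, g = affmap a b /\ `|a| <= rho].

(* [fset_set A] is empty when A is infinite; that case does not arise for
   finitely many affine maps of slope > 1 in absolute value. *)
Definition semigroup_count (R : realType) (m : nat) (f : 'I_m -> R -> R)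
    (rho : R) : nat :=
  #|` fset_set (semigroup f `&` slope_le rho)|%fset.

Definition growth_exponent (R : realType) (m : nat) (f : 'I_m -> R -> R) : R :=
  lim (ln (semigroup_count f rho)%:R / ln rho @[rho --> +oo]).

Definition card_in_ball (R : realType) (E : set R) (x h : R) : \bar R :=
  @counting R R (E `&` [set y | x - h <= y <= x + h]).

Definition locally_finite (R : realType) (E : set R) : Prop :=
  forall B : set R, bounded_set B -> finite_set (E `&` B).

Definition uniformly_locally_finite (R : realType) (E : set R) : Prop :=
  forall rho : R, 0 < rho ->
    (ereal_sup (range (fun x : R => card_in_ball E x rho)) < +oo)%E.

Definition upper_mass (R : realType) (E : set R) (alpha : R) : \bar R :=
  limf_esup (fun h : R => (card_in_ball E 0 h * ((h `^ alpha)^-1)%:E)%E)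
    (+oo : set_system R).

Definition lower_mass (R : realType) (E : set R) (alpha : R) : \bar R :=
  limf_einf (fun h : R => (card_in_ball E 0 h * ((h `^ alpha)^-1)%:E)%E)
    (+oo : set_system R).

Definition upper_mass_dim (R : realType) (E : set R) : \bar R :=
  ereal_inf [set alpha%:E | alpha in
    [set alpha : R | 0 <= alpha /\ (upper_mass E alpha < +oo)%E]].

Definition lower_mass_dim (R : realType) (E : set R) : \bar R :=
  ereal_inf [set alpha%:E | alpha in
    [set alpha : R | 0 <= alpha /\ (lower_mass E alpha < +oo)%E]].

(* The mass dimension exists and equals d. *)
Definition has_mass_dim (R : realType) (E : set R) (d : \bar R) : Prop :=
  upper_mass_dim E = d /\ lower_mass_dim E = d.

Definition upper_beurling_density (R : realType) (E : set R) (alpha : R) :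
    \bar R :=
  limf_esup (fun h : R => ereal_sup (range (fun x : R =>
      (card_in_ball E x h * ((h `^ alpha)^-1)%:E)%E)))
    (+oo : set_system R).

Definition beurling_dim (R : realType) (E : set R) : \bar R :=
  ereal_inf [set alpha%:E | alpha in
    [set alpha : R | 0 < alpha /\ (upper_beurling_density E alpha < +oo)%E]].

(* Main.v *)
Require Import Defs.
From mathcomp Require Import all_boot all_order all_algebra.
From mathcomp Require Import finmap ring lra.
From mathcomp Require Import all_classical all_reals all_analysis.
Set Implicit Arguments.
Unset Strict Implicit.
Unset Printing Implicit Defensive.
Import Order.TTheory GRing.Theory Num.Theory.
Import numFieldNormedType.Exports.
Local Open Scope classical_set_scope.
Local Open Scope ring_scope.

(** Write [N h] for the number of maps in the semigroup whose linear coefficient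
    is at most [h] in absolute value, [N1 h] for the same count with the identity
    included ([word_count]), and [d] for the growth exponent of [N].

    The limit defining [d] exists. Cutting a word where its slope first exceeds
    [A] gives [N1 (A * B) <= N1 (rho * A) * N1 B] ([word_maps_submul]), where [rho] bounds the slopes of the generators;
    Fekete's lemma ([fekete_monotone]) then bounds [N1 A] below by a multiple of
    [A `^ d] and above by a multiple of [A `^ (d + eps)] for each [eps > 0]
    ([word_maps_growth]).

    Upper bounds on the counts. Applying inverse branches to a point [z] of [K]
    until the product of the slopes exceeds [h] writes [z] as [g z'] with [z'] in
    [K] and [h < |g'| <= rho * h] ([invariant_decomposition]). If [z] lies in an
    interval of radius [h], then [z'] lies in an interval of radius one, and in
    a fixed bounded set when the interval of [z] is centred at 0. Hence the
    number of points of [K] in the interval is at most [N1 (rho * h)] times a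
    constant, by local finiteness for the centred intervals
    ([card_centered_ball_le]) and by uniform local finiteness for all of them
    ([card_uniform_ball_le]).

    Lower bound. For [x0] in [K] every [g x0] is in [K], of size at most a
    constant times [|g'|], and [g] is determined by its slope and by [g x0]. A
    slope depends only on how often each generator is used, so at most a power of
    [ln h] slopes are bounded by [h], and up to that factor [N h] is at most the
    number of points of [K] in [- C * h, C * h]
    ([card_centered_ball_lower]).

    These bounds make [d] the threshold of both mass dimensions and of the
    Beurling dimension. If [K] is uniformly locally finite, the count in [- h, h]
    is at most linear in [h], whence [d <= 1]. A set that is not (uniformly)
    locally finite has infinite counts, or infinite suprema of counts, at every
    large scale. *)

(** * Subadditive functions *)

(** Fekete's lemma for a monotone function on the half-line, with an explicit
    bound on either side instead of a limit. *)
Lemma fekete_monotone (R : realType) (u : R -> R) :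
  (forall t, 0 <= t -> 0 <= u t) ->
  (forall s t, 0 <= s -> s <= t -> u s <= u t) ->
  (forall s t, 0 <= s -> 0 <= t -> u (s + t) <= u s + u t) ->
  exists d, [/\ 0 <= d, forall t, 0 < t -> d * t <= u t &
    forall eps, 0 < eps -> exists C, forall t, 0 <= t ->
      u t <= (d + eps) * t + C].
Proof.
move=> u0 umono usub.
pose S := [set u t / t | t in [set t | 0 < t]].
have S0 : S !=set0 by exists (u 1 / 1); exists 1 => //=.
have Slb : lbound S 0 by move=> _ [t /= t0 <-]; rewrite divr_ge0 ?u0 // ltW.
have Sinf : has_inf S by split=> //; exists 0.
exists (inf S); split; first exact: lb_le_inf.
  move=> t t0; rewrite -ler_pdivlMr //; apply: ge_inf; first by exists 0.
  by exists t.
move=> eps eps0.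
have [_ [t0 /= t00 <-] ut0] := inf_adherent eps0 Sinf.
have {}ut0 : u t0 <= (inf S + eps) * t0 by rewrite -ler_pdivrMr // ltW.
have multiples n s : 0 <= s -> u (n%:R * t0 + s) <= n%:R * u t0 + u s.
  move=> s0; elim: n => [|n IH]; first by rewrite !mul0r !add0r.
  rewrite -natr1 !mulrDl !mul1r.
  have -> : n%:R * t0 + t0 + s = t0 + (n%:R * t0 + s) by ring.
  have := usub t0 (n%:R * t0 + s) (ltW t00).
  have n0 : 0 <= n%:R * t0 + s by rewrite addr_ge0 // mulr_ge0 // ltW.
  by move=> /(_ n0); lra.
exists (u t0) => t tge0.
have q0 : 0 <= t / t0 by rewrite divr_ge0 // ltW.
have /andP[q1 q2] := truncn_itv q0; set q := Num.trunc _ in q1 q2.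
rewrite ler_pdivlMr // in q1; rewrite ltr_pdivrMr // -natr1 in q2.
have s0 : 0 <= t - q%:R * t0 by lra.
have := multiples q _ s0; rewrite [X in u X]addrC subrK => h.
have h1 : u (t - q%:R * t0) <= u t0 by apply: umono => //; lra.
have h2 : q%:R * u t0 <= q%:R * ((inf S + eps) * t0) by rewrite ler_wpM2l.
have S1 : 0 <= inf S by exact: lb_le_inf.
have h3 : (inf S + eps) * (q%:R * t0) <= (inf S + eps) * t.
  by rewrite ler_wpM2l //; lra.
lra.
Qed.

(** * Cardinalities of finite sets *)

Lemma card_fset_set_subset (T : choiceType) (A B : set T) :
  finite_set B -> A `<=` B -> (#|` fset_set A| <= #|` fset_set B|)%N.
Proof.
move=> finB AB; have finA := sub_finite_set AB finB.
by rewrite fsubset_leq_card // -fset_set_sub.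
Qed.

Lemma card_fset_set_image (T U : choiceType) (F : T -> U) (A : set T) :
  finite_set A -> (#|` fset_set (F @` A)| <= #|` fset_set A|)%N.
Proof. by move=> finA; rewrite fset_set_image // leq_imfset_card. Qed.

Lemma card_fset_set_seq (T : choiceType) (A : set T) (s : seq T) :
  (forall x, A x -> x \in s) ->
  finite_set A /\ (#|` fset_set A| <= size s)%N.
Proof.
move=> As; have finA : finite_set A.
  by apply: (sub_finite_set _ (finite_seq s)) => x /As.
split=> //; apply: uniq_leq_size; first exact: fset_uniq.
by move=> x; rewrite in_fset_set // inE => /As.
Qed.

Lemma card_fset_set_cover (T U : choiceType) (A : set T) (Y : T -> set U)
    (X : set U) (M : nat) :
  finite_set A ->
  (forall a, A a -> finite_set (Y a) /\ (#|` fset_set (Y a)| <= M)%N) ->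
  (forall x, X x -> exists2 a, A a & Y a x) ->
  finite_set X /\ (#|` fset_set X| <= #|` fset_set A| * M)%N.
Proof.
move=> finA YM XY.
pose s := [seq y | a <- fset_set A, y <- enum_fset (fset_set (Y a))].
have [finX Xs] : finite_set X /\ (#|` fset_set X| <= size s)%N.
  apply: card_fset_set_seq => x /XY[a Aa Yax].
  apply/allpairsPdep; exists a, x; split=> //.
    by rewrite in_fset_set // inE.
  by rewrite in_fset_set ?inE //; case: (YM a Aa).
split=> //; apply: leq_trans Xs _; rewrite /s size_allpairs_dep.
have : forall a, a \in enum_fset (fset_set A) -> A a.
  by move=> a; rewrite in_fset_set // inE.
elim: (enum_fset _) => //= a l IH lA.
rewrite mulSn leq_add //; first by case: (YM a (lA a (mem_head _ _))).
by apply: IH => c cl; apply: lA; rewrite inE cl orbT.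
Qed.

Lemma locally_finite_ball (R : realType) (K : set R) (x h : R) :
  locally_finite K -> finite_set (K `&` [set y | x - h <= y <= x + h]).
Proof.
move=> lfK; apply: lfK; exists (`|x| + `|h|); split=> [|M hM y /= yh].
  by rewrite num_real.
apply: le_trans (ltW hM); rewrite ler_norml.
have := ler_norm x; have := lerNnormlW (lexx `|x|); have := ler_norm h.
lra.
Qed.

(** * Slopes of compositions *)

(** The linear coefficient of the composition of the maps listed in [w]. *)
Definition word_slope {R : realType} {m : nat} (r : 'I_m -> R) (w : seq 'I_m) : R :=
  \prod_(i <- w) r i.

(** The compositions, the empty one included, whose linear coefficient is at
    most [rad] in absolute value. Including the identity makes their number
    submultiplicative. *)
Definition word_maps {R : realType} {m : nat} (r : 'I_m -> R)
    (f : 'I_m -> R -> R) (rad : R) : set (R -> R) :=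
  [set g | exists2 w, `|word_slope r w| <= rad & g = word_map f w].

(** The number of such maps. *)
Definition word_count {R : realType} {m : nat} (r : 'I_m -> R)
    (f : 'I_m -> R -> R) (rad : R) : nat := #|` fset_set (word_maps r f rad)|.

Lemma word_map_cat (R : realType) (m : nat) (f : 'I_m -> R -> R)
    (w1 w2 : seq 'I_m) :
  word_map f (w1 ++ w2) = word_map f w1 \o word_map f w2.
Proof. by elim: w1 => //= i w1 ->. Qed.

Lemma word_slope_cons (R : realType) (m : nat) (r : 'I_m -> R) i w :
  word_slope r (i :: w) = r i * word_slope r w.
Proof. by rewrite /word_slope big_cons. Qed.

Lemma affmap_slope_inj (R : realType) (a b a' b' : R) :
  affmap a b = affmap a' b' -> a = a'.
Proof.
move=> e; have := congr1 (@^~ 1) e; have := congr1 (@^~ 0) e.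
by rewrite /affmap !mulr0 !mulr1 !add0r => -> /addIr.
Qed.

Section ExpandingMaps.
Context {R : realType} {m : nat} {r b : 'I_m -> R} {f : 'I_m -> R -> R}.
Hypothesis hf : forall i, f i = affmap (r i) (b i).
Context {lam rho beta : R}.
Hypothesis lam_gt1 : 1 < lam.
Hypothesis lam_le : forall i, lam <= `|r i|.
Hypothesis rho_ge1 : 1 <= rho.
Hypothesis le_rho : forall i, `|r i| <= rho.
(* [- beta, beta] is mapped into itself by the inverse of every [f i]. *)
Hypothesis le_beta : forall i, `|b i| <= beta * (`|r i| - 1).
Hypothesis beta_ge1 : 1 <= beta.

Let beta_ge0 : 0 <= beta := le_trans ler01 beta_ge1.
Let lam_gt0 : 0 < lam := lt_trans ltr01 lam_gt1.
Local Notation N1 := (word_count r f).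

Lemma word_map_affine (w : seq 'I_m) (x : R) :
  word_map f w x = word_slope r w * x + word_map f w 0.
Proof.
elim: w x => [|i w IH] x; first by rewrite /word_slope big_nil mul1r addr0.
rewrite word_slope_cons /= IH hf /affmap; ring.
Qed.

Lemma word_mapE (w : seq 'I_m) :
  word_map f w = affmap (word_slope r w) (word_map f w 0).
Proof. by apply/funext => x; exact: word_map_affine. Qed.

Lemma lam_le_word_slope (w : seq 'I_m) : lam ^+ size w <= `|word_slope r w|.
Proof.
elim: w => [|i w IH]; first by rewrite /word_slope big_nil normr1.
by rewrite word_slope_cons normrM exprS ler_pM // ?exprn_ge0 // ltW.
Qed.

(** With the shift by [beta], sizes are multiplied by at most the slope, and at
    least by the slope in [word_map_escape]. *)
Lemma word_map_growth (w : seq 'I_m) (x : R) :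
  `|word_map f w x| + beta <= `|word_slope r w| * (`|x| + beta).
Proof.
elim: w => [|i w IH]; first by rewrite /word_slope big_nil normr1 mul1r.
rewrite word_slope_cons normrM /= hf /affmap -mulrA.
have h1 := ler_normD (r i * word_map f w x) (b i); rewrite normrM in h1.
have h2 := le_beta i.
have h3 : `|r i| * (`|word_map f w x| + beta)
    <= `|r i| * (`|word_slope r w| * (`|x| + beta)) by rewrite ler_wpM2l.
lra.
Qed.

Lemma word_map_escape (w : seq 'I_m) (x : R) :
  `|word_slope r w| * (`|x| - beta) <= `|word_map f w x| - beta.
Proof.
elim: w => [|i w IH]; first by rewrite /word_slope big_nil normr1 mul1r.
rewrite word_slope_cons normrM /= hf /affmap -mulrA.
have h1 := lerB_normD (r i * word_map f w x) (b i); rewrite normrM in h1.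
have h2 := le_beta i.
have h3 : `|r i| * (`|word_slope r w| * (`|x| - beta))
    <= `|r i| * (`|word_map f w x| - beta) by rewrite ler_wpM2l.
lra.
Qed.

Lemma finite_word_size (n : nat) : finite_set [set w : seq 'I_m | (size w <= n)%N].
Proof.
have -> : [set w : seq 'I_m | (size w <= n)%N] =
    \bigcup_(k in [set k | (k < n.+1)%N]) range (@tval k 'I_m).
  apply/seteqP; split=> [w /= wn|w [k /= kn [t _ <-]]].
    by exists (size w) => //=; exists (in_tuple w).
  by rewrite size_tuple.
by apply: bigcup_finite => [|k _]; [exact: finite_II|exact: finite_image].
Qed.

Lemma size_word_le (w : seq 'I_m) (n : nat) (rad : R) :
  `|word_slope r w| <= rad -> rad <= lam ^+ n -> (size w <= n)%N.
Proof.
move=> wrad radn.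
by rewrite -(ler_eXn2l lam_gt1) (le_trans (lam_le_word_slope w)) ?(le_trans wrad).
Qed.

Lemma ln_lam_gt0 : 0 < ln lam.
Proof. exact: ln_gt0. Qed.

(** A number of factors after which every slope is at least [rad]. *)
Definition depth (rad : R) : nat := (Num.trunc (ln rad / ln lam)).+1.

Lemma le_lam_depth (rad : R) : 1 <= rad -> rad <= lam ^+ depth rad.
Proof.
move=> rad1; have rad0 : 0 < rad by lra.
have t0 : 0 <= ln rad / ln lam by rewrite divr_ge0 ?ln_ge0 // ltW.
rewrite -ler_ln ?posrE ?exprn_gt0 // lnXn //.
have /andP[_ /ltW] := truncn_itv t0.
by rewrite ler_pdivrMr ?ln_lam_gt0 // mulr_natl.
Qed.

Lemma depth_le (rad : R) : 1 <= rad -> (depth rad)%:R <= ln rad / ln lam + 1.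
Proof.
move=> rad1; have t0 : 0 <= ln rad / ln lam by rewrite divr_ge0 ?ln_ge0 // ltW.
by have /andP[h _] := truncn_itv t0; rewrite /depth -natr1 lerD2r.
Qed.

(** Words whose slope is bounded have bounded length. *)
Lemma finite_word_maps (rad : R) : finite_set (word_maps r f rad).
Proof.
have rad1 : 1 <= Num.max 1 rad by rewrite le_max lexx.
pose n := depth (Num.max 1 rad).
apply: (sub_finite_set _ (finite_image (word_map f) (finite_word_size n))).
move=> g [w wrad ->]; exists w => //=.
apply: size_word_le _ (le_lam_depth rad1).
by rewrite (le_trans wrad) // le_max lexx orbT.
Qed.

(** * Decomposition of the points of an invariant set *)

(** A product of expanding slopes passes from below [h] to above [h] without
    leaving the window of ratio [rho]. *)
Lemma invariant_decomposition (K : set R) (h : R) (z : R) :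
  K = \bigcup_(i in [set: 'I_m]) (f i @` K) -> 1 <= h -> K z ->
  exists w z', [/\ w != [::], h < `|word_slope r w|,
    `|word_slope r w| <= rho * h, K z' & z = word_map f w z'].
Proof.
move=> hK h1 Kz.
have := le_lam_depth h1; move: (depth h) => n.
elim: n h h1 z Kz => [|n IH] h h1 z Kz hn; rewrite hK in Kz.
all: case: Kz => i _ [z1 Kz1 <-].
all: have [ir|ri] := ltP h `|r i|.
- exists [:: i], z1; rewrite /word_slope big_seq1; split => //.
  by have := le_rho i; nra.
- by have := lam_le i; have := lam_gt1; lra.
- exists [:: i], z1; rewrite /word_slope big_seq1; split => //.
  by have := le_rho i; nra.
have ri0 : 0 < `|r i| by have := lam_le i; have := lam_gt1; lra.
have h1' : 1 <= h / `|r i| by rewrite ler_pdivlMr // mul1r.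
have hn' : h / `|r i| <= lam ^+ n.
  by rewrite ler_pdivrMr // (le_trans hn) // exprSr ler_wpM2l // exprn_ge0 // ltW.
have [w [z2 [_ hw wh Kz2 ->]]] := IH _ h1' _ Kz1 hn'.
exists (i :: w), z2; rewrite word_slope_cons normrM; split=> //.
  by rewrite ltr_pdivrMr // mulrC in hw.
by rewrite mulrA ler_pdivlMr // mulrC in wh.
Qed.

Lemma invariant_word_map (K : set R) (w : seq 'I_m) (x : R) :
  K = \bigcup_(i in [set: 'I_m]) (f i @` K) -> K x -> K (word_map f w x).
Proof.
move=> hK Kx; elim: w => //= i w IH; rewrite hK.
by exists i => //; exists (word_map f w x).
Qed.

(** * Growth of the number of compositions *)

(** A word is cut just after its slope exceeds [A], if it ever does. *)
Lemma word_split (w : seq 'I_m) (A B : R) :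
  1 <= A -> 1 <= B -> `|word_slope r w| <= A * B ->
  exists w1 w2, [/\ w = w1 ++ w2, `|word_slope r w1| <= rho * A &
    `|word_slope r w2| <= B].
Proof.
elim: w A => [|i w IH] A A1 B1 wAB.
  exists [::], [::]; split=> //; rewrite /word_slope big_nil normr1 //.
  by have := rho_ge1; nra.
have ri0 : 0 < `|r i| := lt_le_trans lam_gt0 (lam_le i).
rewrite word_slope_cons normrM in wAB.
have [ir|ri] := ltP A `|r i|.
  exists [:: i], w; split=> //.
    by rewrite /word_slope big_seq1; have := le_rho i; nra.
  rewrite -(ler_pM2l ri0) (le_trans wAB) // ler_wpM2r //; lra.
have A1' : 1 <= A / `|r i| by rewrite ler_pdivlMr // mul1r.
have wAB' : `|word_slope r w| <= A / `|r i| * B.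
  by rewrite mulrAC ler_pdivlMr // mulrC.
have [w1 [w2 [-> h1 h2]]] := IH _ A1' B1 wAB'.
exists (i :: w1), w2; split=> //.
by rewrite word_slope_cons normrM; rewrite mulrA ler_pdivlMr // mulrC in h1.
Qed.

Lemma word_maps_submul (A B : R) : 1 <= A -> 1 <= B ->
  (N1 (A * B) <= N1 (rho * A) * N1 B)%N.
Proof.
move=> A1 B1.
pose Y (g : R -> R) := (fun g2 : R -> R => g \o g2) @` word_maps r f B.
apply: (proj2 (card_fset_set_cover (Y := Y) (finite_word_maps _) _ _)).
  move=> g _; split; first exact/finite_image/finite_word_maps.
  exact/card_fset_set_image/finite_word_maps.
move=> g [w wAB ->].
have [w1 [w2 [-> h1 h2]]] := word_split A1 B1 wAB.
exists (word_map f w1); first by exists w1.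
by exists (word_map f w2); [exists w2|rewrite word_map_cat].
Qed.

Lemma le_word_maps (A B : R) : A <= B -> (N1 A <= N1 B)%N.
Proof.
move=> AB; apply: card_fset_set_subset (finite_word_maps _) _.
by move=> g [w wA ->]; exists w => //; exact: le_trans AB.
Qed.

Lemma word_maps_gt0 (A : R) : 1 <= A -> (0 < N1 A)%N.
Proof.
move=> A1; rewrite /word_count -(cardfs1 (@id R)) -fset_set1.
apply: card_fset_set_subset (finite_word_maps _) _ => _ ->.
by exists [::] => //; rewrite /word_slope big_nil normr1.
Qed.

(** Fekete's lemma is applied to the logarithm of the count at
    [rho * expR t]; the factor [rho] absorbs the one of [word_maps_submul]. *)
Lemma word_maps_growth : exists2 d, 0 <= d &
  (forall A, rho < A -> (A / rho) `^ d <= (N1 A)%:R) /\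
  (forall eps, 0 < eps -> exists2 C, 0 < C &
    forall A, 1 <= A -> (N1 A)%:R <= C * A `^ (d + eps)).
Proof.
have rho1 := rho_ge1; have rho0 : 0 < rho by lra.
pose u (t : R) : R := ln (N1 (rho * expR t))%:R.
have ge1 t : 0 <= t -> 1 <= rho * expR t.
  by move=> t0; rewrite -[1]mulr1 ler_pM // -expR0 ler_expR.
have pos t : 0 <= t -> (0 : R) < (N1 (rho * expR t))%:R.
  by move=> t0; rewrite ltr0n word_maps_gt0 // ge1.
have [||s t s0 t0|d [d0 dlow dup]] := @fekete_monotone R u.
- by move=> t t0; rewrite ln_ge0 // ler1n word_maps_gt0 // ge1.
- move=> s t s0 st; rewrite ler_ln ?posrE ?pos //; last exact: le_trans st.
  by rewrite ler_nat le_word_maps // ler_wpM2l ?ler_expR // ltW.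
- rewrite -lnM ?posrE ?pos // ler_ln ?posrE ?mulr_gt0 ?pos //; last lra.
  rewrite -natrM ler_nat expRD mulrCA; apply: word_maps_submul.
    by rewrite -expR0 ler_expR.
  exact: ge1.
have uE A : 0 < A -> u (ln (A / rho)) = ln (N1 A)%:R.
  by move=> A0; rewrite /u lnK ?posrE ?divr_gt0 // mulrC divfK // gt_eqF.
exists d => //; split=> [A Arho|eps eps0].
  have A0 : 0 < A by lra.
  have Ar : 1 < A / rho by rewrite ltr_pdivlMr // mul1r.
  rewrite -ler_ln ?posrE ?powR_gt0 ?ltr0n ?word_maps_gt0 //; try lra.
  by rewrite ln_powR -uE // dlow // ln_gt0.
have [C HC] := dup _ eps0; exists (expR C) => [|A A1]; first exact: expR_gt0.
have A0 : 0 < A by lra.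
apply: (@le_trans _ _ (N1 (rho * A))%:R).
  by rewrite ler_nat le_word_maps // ler_peMl // ltW.
rewrite -ler_ln ?posrE ?mulr_gt0 ?expR_gt0 ?powR_gt0 //; last first.
  by rewrite ltr0n word_maps_gt0 // -[1]mulr1 ler_pM.
rewrite lnM ?posrE ?expR_gt0 ?powR_gt0 // expRK ln_powR.
have := HC (ln A) (ln_ge0 A1); rewrite /u lnK ?posrE //; lra.
Qed.

(** A slope is determined by the number of occurrences of each index. *)
Lemma word_slope_count (w : seq 'I_m) :
  word_slope r w = \prod_(i < m) r i ^+ count_mem i w.
Proof.
elim: w => [|i w IH]; first by rewrite /word_slope big_nil big1.
rewrite word_slope_cons IH /=.
under [RHS]eq_bigr do rewrite exprD.
rewrite big_split /=; congr (_ * _).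
by rewrite (bigD1 i) //= eqxx big1 ?mulr1 // => j /negPf ij; rewrite eq_sym ij.
Qed.

Lemma card_word_slopes (rad : R) : 1 <= rad ->
  let S := [set c | exists2 w, `|word_slope r w| <= rad & c = word_slope r w] in
  finite_set S /\ (#|` fset_set S| <= (depth rad).+1 ^ m)%N.
Proof.
move=> rad1 S; set n := depth rad.
pose s := [seq \prod_(i < m) r i ^+ g i | g : {ffun 'I_m -> 'I_n.+1}].
have -> : ((n.+1 ^ m) = size s)%N.
  by rewrite size_map -cardE card_ffun !card_ord.
apply: card_fset_set_seq => c [w wrad ->].
have wn : (size w <= n)%N := size_word_le wrad (le_lam_depth rad1).
have cn i : (count_mem i w < n.+1)%N by rewrite ltnS (leq_trans (count_size _ _)).
apply/mapP; exists [ffun i => Ordinal (cn i)]; first by rewrite mem_enum.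
by rewrite word_slope_count; apply: eq_bigr => i _; rewrite ffunE.
Qed.

(** * Counting the points of an invariant set *)

(** A composition is determined by its slope and by the image of one point. *)
Lemma word_maps_le_card (K : set R) (x0 rad : R) :
  K = \bigcup_(i in [set: 'I_m]) (f i @` K) -> K x0 -> 1 <= rad ->
  let B := K `&` [set y | 0 - rad * (`|x0| + beta) <= y <= 0 + rad * (`|x0| + beta)] in
  finite_set B -> (N1 rad <= (depth rad).+1 ^ m * #|` fset_set B|)%N.
Proof.
move=> hK Kx0 rad1 B finB.
have [finS cardS] := card_word_slopes rad1; set S := [set c | _] in finS cardS.
pose Y c := (fun z => affmap c (z - c * x0)) @` B.
have [_] : finite_set (word_maps r f rad) /\
    (N1 rad <= #|` fset_set S| * #|` fset_set B|)%N.
  apply: (card_fset_set_cover (Y := Y) finS).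
    by move=> c _; split; [exact: finite_image|exact: card_fset_set_image].
  move=> g [w wrad ->]; exists (word_slope r w); first by exists w.
  exists (word_map f w x0).
    split; first exact: invariant_word_map.
    rewrite /= sub0r add0r -ler_norml.
    have := word_map_growth w x0.
    have : `|word_slope r w| * (`|x0| + beta) <= rad * (`|x0| + beta).
      by rewrite ler_wpM2r // addr_ge0.
    have := beta_ge0; lra.
  by rewrite [RHS]word_mapE; congr affmap; rewrite word_map_affine; ring.
by move/leq_trans; apply; rewrite leq_mul2r cardS orbT.
Qed.

(** Decomposing at scale [h] splits the points of [K] in an interval among at most
    [N1 (rho * h)] maps, and [M] bounds the number of points for each map. *)
Lemma card_ball_le (K : set R) (x h : R) (M : nat) :
  K = \bigcup_(i in [set: 'I_m]) (f i @` K) -> 1 <= h ->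
  (forall w, h < `|word_slope r w| ->
    let P := K `&` word_map f w @^-1` [set y | x - h <= y <= x + h] in
    finite_set P /\ (#|` fset_set P| <= M)%N) ->
  let B := K `&` [set y | x - h <= y <= x + h] in
  finite_set B /\ (#|` fset_set B| <= N1 (rho * h) * M)%N.
Proof.
move=> hK h1 PM B.
pose A := [set g | exists w, [/\ h < `|word_slope r w|,
  `|word_slope r w| <= rho * h & g = word_map f w]].
have AN : A `<=` word_maps r f (rho * h) by move=> g [w [_ wh ->]]; exists w.
pose Y (g : R -> R) := g @` (K `&` g @^-1` [set y | x - h <= y <= x + h]).
have [finB] : finite_set B /\ (#|` fset_set B| <= #|` fset_set A| * M)%N.
  apply: (card_fset_set_cover (Y := Y)).
  - exact: sub_finite_set AN (finite_word_maps _).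
  - move=> g [w [hw _ ->]]; have [finP PM'] := PM w hw.
    split; first exact: finite_image.
    exact: leq_trans (card_fset_set_image _ finP) PM'.
  - move=> z [Kz zI].
    have [w [z' [_ hw wh Kz' zE]]] := invariant_decomposition hK h1 Kz.
    exists (word_map f w); first by exists w.
    by exists z' => //; split=> //=; rewrite -zE.
move=> cardB; split=> //; apply: leq_trans cardB _.
by rewrite leq_mul2r card_fset_set_subset ?orbT //; exact: finite_word_maps.
Qed.

(** A point that a slope larger than [h] sends into [- h, h] lies in
    [- (beta + 1), beta + 1]. *)
Lemma card_centered_ball_le (K : set R) (h : R) :
  K = \bigcup_(i in [set: 'I_m]) (f i @` K) -> 1 <= h ->
  finite_set (K `&` [set y | `|y| <= beta + 1]) ->
  let B := K `&` [set y | 0 - h <= y <= 0 + h] in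
  finite_set B /\ (#|` fset_set B| <=
    N1 (rho * h) * #|` fset_set (K `&` [set y | (`|y| <= beta + 1)%R])|)%N.
Proof.
move=> hK h1 fin; apply: card_ball_le => // w hw P.
have PK : P `<=` K `&` [set y | `|y| <= beta + 1].
  move=> z [Kz]; rewrite /= sub0r add0r -ler_norml => zh; split=> //=.
  have esc := word_map_escape w z; have b0 := beta_ge0.
  rewrite leNgt; apply/negP => zb.
  have : 0 <= `|word_slope r w| * (`|z| - beta - 1) by rewrite mulr_ge0 //; lra.
  lra.
split; first exact: sub_finite_set PK fin.
exact: card_fset_set_subset.
Qed.

(** A map of slope larger than [h] pulls an interval of radius [h] back into an
    interval of radius one. *)
Lemma card_uniform_ball_le (K : set R) (M : nat) (x h : R) :
  K = \bigcup_(i in [set: 'I_m]) (f i @` K) -> 1 <= h ->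
  (forall y, let D := K `&` [set z | y - 1 <= z <= y + 1] in
    finite_set D /\ (#|` fset_set D| <= M)%N) ->
  let B := K `&` [set y | x - h <= y <= x + h] in
  finite_set B /\ (#|` fset_set B| <= N1 (rho * h) * M)%N.
Proof.
move=> hK h1 unif; apply: card_ball_le => // w hw P.
set c := word_slope r w in hw.
have c0 : c != 0 by rewrite -normr_gt0; lra.
pose y := (x - word_map f w 0) / c.
have PD : P `<=` K `&` [set z | y - 1 <= z <= y + 1].
  move=> z [Kz] /=; rewrite word_map_affine -/c => zI; split=> //=.
  have : `|c| * `|z - y| <= h.
    rewrite -normrM ler_norml.
    have -> : c * (z - y) = c * z + word_map f w 0 - x by rewrite /y; field.
    by move: zI; lra.
  have : `|z - y| <= 1 -> y - 1 <= z <= y + 1 by rewrite ler_norml; lra.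
  move=> H H'; apply: H; rewrite leNgt; apply/negP => far.
  have : 0 <= `|c| * (`|z - y| - 1) by rewrite mulr_ge0 //; lra.
  lra.
have [finD DM] := unif y.
split; first exact: sub_finite_set PD finD.
exact: leq_trans (card_fset_set_subset finD PD) DM.
Qed.

(** The number of slopes grows more slowly than every power. *)
Lemma depth_exp_le (eta : R) : 0 < eta ->
  exists2 D, 0 < D & forall A, 1 <= A ->
    ((depth A).+1 ^ m)%:R <= D * A `^ eta.
Proof.
move=> eta0; pose delta := eta / m.+1%:R.
(* The exponent is shared among the [m] counts; [m.+1] avoids a zero divisor. *)
have delta0 : 0 < delta by rewrite divr_gt0.
have l0 := ln_lam_gt0.
pose D := 2 + (delta * ln lam)^-1.
have D0 : 0 < D by rewrite addr_gt0 // invr_gt0 mulr_gt0.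
exists (D ^+ m) => [|A A1]; first exact: exprn_gt0.
have A0 : 0 < A by lra.
have lnA : 0 <= ln A by exact: ln_ge0.
have Ad : 1 + delta * ln A <= A `^ delta.
  by rewrite /powR gt_eqF // expR_ge1Dx.
have step : (depth A).+1%:R <= D * A `^ delta.
  have := depth_le A1; rewrite -natr1 => h.
  have -> : D * A `^ delta = 2 * A `^ delta + A `^ delta / (delta * ln lam).
    by rewrite /D; ring.
  have Ad1 : 1 <= A `^ delta.
    by apply: le_trans Ad; rewrite lerDl mulr_ge0 // ltW.
  have h1 : ln A / ln lam <= A `^ delta / (delta * ln lam).
    rewrite ler_pdivlMr ?mulr_gt0 //.
    have -> : ln A / ln lam * (delta * ln lam) = delta * ln A.
      by field; rewrite gt_eqF.
    lra.
  lra.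
rewrite natrX; apply: (le_trans (lerXn2r m _ _ step)).
- by rewrite nnegrE.
- by rewrite nnegrE mulr_ge0 ?powR_ge0 // ltW.
rewrite exprMn ler_pM2l ?exprn_gt0 // -powR_mulrn ?powR_ge0 // -powRrM ler_powR //.
by rewrite /delta mulrAC ler_pdivrMr // ler_pM2l // ler_nat leqnSn.
Qed.

(** The loss of [eta] in the exponent accounts for the compositions of different
    slopes that send a chosen point of [K] to the same point. *)
Lemma card_centered_ball_lower (K : set R) (d eta : R) :
  invariant_set f K -> locally_finite K -> 0 < eta ->
  (forall A, rho < A -> (A / rho) `^ d <= (N1 A)%:R) ->
  exists c H, 0 < c /\ forall h, H <= h ->
    c * h `^ (d - eta) <=
    #|` fset_set (K `&` [set y | (0 - h <= y <= 0 + h)%R])|%:R.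
Proof.
move=> [[x0 Kx0] hK] lfK eta0 low.
have rho1 := rho_ge1; have beta1 := beta_ge1; have beta0 := beta_ge0.
have [D D0 HD] := depth_exp_le eta0.
(* Slopes up to [h / C] send [x0] into [- h, h]. *)
pose C := `|x0| + beta; have C0 : 0 < C by rewrite ltr_wpDl //; lra.
exists ((rho `^ d)^-1 * D^-1 * (C^-1) `^ (d - eta)).
exists (C * (rho + 1)); split=> [|h hH].
  by rewrite !mulr_gt0 // ?invr_gt0 ?powR_gt0 ?invr_gt0 //; lra.
set A := h / C.
have hE : h = A * C by rewrite divfK ?gt_eqF.
have Arho : rho < A by rewrite ltr_pdivlMr //; nra.
have A1 : 1 <= A by lra.
have A0 : 0 < A by lra.
have finB := locally_finite_ball 0 h lfK.
have count : (N1 A <= (depth A).+1 ^ m *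
    #|` fset_set (K `&` [set y | (0 - h <= y <= 0 + h)%R])|)%N.
  by move: finB; rewrite hE; exact: word_maps_le_card.
set n := #|` _| in count *.
have {}count : (N1 A)%:R <= D * A `^ eta * n%:R :> R.
  move: count; rewrite -(ler_nat R) natrM => /le_trans; apply.
  by rewrite ler_wpM2r // HD.
have -> : (C^-1) `^ (d - eta) = A `^ (d - eta) / h `^ (d - eta).
  have h0 : 0 < h by rewrite hE mulr_gt0.
  have -> : A = h * C^-1 by [].
  rewrite powRM ?invr_ge0 ?ltW // mulrAC divff ?mul1r //.
  by rewrite gt_eqF // powR_gt0.
have h0 : 0 < h by rewrite hE mulr_gt0.
rewrite mulrA mulfVK ?gt_eqF ?powR_gt0 //.
have rho0 : 0 < rho by lra.
have key := le_trans (low _ Arho) count.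
have rhod : (A / rho) `^ d = A `^ d / rho `^ d.
  have Er : A = A / rho * rho by rewrite divfK ?gt_eqF.
  rewrite [in RHS]Er [in RHS]powRM ?divr_ge0 ?ltW //.
  by rewrite mulfK // gt_eqF // powR_gt0.
rewrite rhod in key.
have -> : A `^ (d - eta) = A `^ d / A `^ eta.
  by rewrite powRD ?powRN //; apply/implyP => _; rewrite gt_eqF.
have pe : 0 < A `^ eta by exact: powR_gt0.
have -> : (rho `^ d)^-1 / D * (A `^ d / A `^ eta) =
    (A `^ d / rho `^ d) / (D * A `^ eta).
  by field; rewrite !gt_eqF // powR_gt0 //; lra.
by rewrite ler_pdivrMr ?mulr_gt0 // [leRHS]mulrC.
Qed.

Lemma word_count_scaled_le (e C : R) (M : nat) :
  (forall A, 1 <= A -> (N1 A)%:R <= C * A `^ e) -> 0 < C ->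
  exists2 C', 0 <= C' & forall h, 1 <= h ->
    (N1 (rho * h) * M)%:R <= C' * h `^ e.
Proof.
move=> up C0; have rho1 := rho_ge1.
exists (C * rho `^ e * M%:R) => [|h h1].
  by rewrite !mulr_ge0 // ?powR_ge0 // ltW.
have A1 : 1 <= rho * h by nra.
rewrite natrM.
have -> : C * rho `^ e * M%:R * h `^ e = C * (rho * h) `^ e * M%:R.
  by rewrite powRM; [ring|lra|lra].
by rewrite ler_wpM2r // up.
Qed.

Lemma semigroup_sub_word_maps (A : R) :
  semigroup f `&` slope_le A `<=` word_maps r f A.
Proof.
move=> g [[w _ gw] [a [c [gac aA]]]]; exists w => //.
by move: gac; rewrite gw word_mapE => /affmap_slope_inj ->.
Qed.

Lemma semigroup_count_le (A : R) : (semigroup_count f A <= N1 A)%N.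
Proof.
exact: card_fset_set_subset (finite_word_maps _) (@semigroup_sub_word_maps A).
Qed.

(** The identity is the only map of [word_maps] that may be missing from the
    semigroup; once [A] reaches [rho] the semigroup part is nonempty, so adding
    the identity at most doubles the count. *)
Lemma word_count_le (i0 : 'I_m) (A : R) :
  rho <= A -> (N1 A <= 2 * semigroup_count f A)%N.
Proof.
move=> rhoA; set S := semigroup f `&` slope_le A.
have inS w : w != [::] -> `|word_slope r w| <= A -> S (word_map f w).
  by move=> w0 wA; split; [exists w|exists (word_slope r w), (word_map f w 0); rewrite -word_mapE].
have finS : finite_set S :=
  sub_finite_set (@semigroup_sub_word_maps A) (finite_word_maps _).
have S1 : (0 < #|` fset_set S|)%N.
  rewrite -(cardfs1 (word_map f [:: i0])) -fset_set1.
  apply: card_fset_set_subset => // _ ->; apply: inS => //.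
  by rewrite /word_slope big_seq1 (le_trans (le_rho _)).
have NS : word_maps r f A `<=` id |` S.
  by move=> g [[|i w] wA ->]; [left|right; exact: inS].
have h : (N1 A <= #|` fset_set (id |` S)|)%N.
  by apply: card_fset_set_subset => //; rewrite finite_setU; split.
apply: leq_trans h _; rewrite fset_setU1 // (leq_trans (leq_card_fsetU _ _)) //.
by rewrite cardfs1 mul2n -addnn leq_add2r.
Qed.

End ExpandingMaps.

(** * Upper and lower limits at infinity *)

Lemma limf_esup_pinfty_lt (R : realType) (g : R -> \bar R) (C H : R) :
  (forall h, H <= h -> (g h <= C%:E)%E) ->
  (limf_esup g (+oo%R : set_system R) < +oo)%E.
Proof.
move=> gC; apply: (@le_lt_trans _ _ C%:E); last exact: ltry.
rewrite limf_esupE; apply: ge_ereal_inf.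
exists (ereal_sup (g @` [set h | H <= h])).
  exists [set h | H <= h] => //; exact: nbhs_pinfty_ge (num_real H).
by apply: ge_ereal_sup => _ [h /= Hh <-]; exact: gC.
Qed.

Lemma limf_einf_le_esup (R : realType) (g : R -> \bar R) :
  (limf_einf g (+oo%R : set_system R) <= limf_esup g (+oo%R : set_system R))%E.
Proof.
rewrite limf_esupE limf_einfE.
apply: ge_ereal_sup => _ [U FU <-]; apply: le_ereal_inf_tmp => _ [V FV <-].
have [h [Uh Vh]] : (U `&` V) !=set0.
  by apply: (@filter_ex _ (+oo%R : set_system R)); exact: filterI.
apply: (@le_trans _ _ (g h)).
  by apply: ge_ereal_inf; exists (g h) => //; exists h.
by apply: le_ereal_sup_tmp; exists (g h) => //; exists h.
Qed.

Lemma limf_einf_pinfty (R : realType) (g : R -> \bar R) :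
  (forall M : R, exists H : R, forall h, H <= h -> (M%:E <= g h)%E) ->
  limf_einf g (+oo%R : set_system R) = +oo%E.
Proof.
move=> gM; apply: eq_infty => M; rewrite limf_einfE.
have [H gH] := gM M.
apply: le_ereal_sup_tmp; exists (ereal_inf (g @` [set h | H <= h])).
  exists [set h | H <= h] => //; exact: nbhs_pinfty_ge (num_real H).
by apply: le_ereal_inf_tmp => _ [h /= Hh <-]; exact: gH.
Qed.

Lemma limf_esup_pinfty (R : realType) (g : R -> \bar R) :
  (forall M : R, exists H : R, forall h, H <= h -> (M%:E <= g h)%E) ->
  limf_esup g (+oo%R : set_system R) = +oo%E.
Proof.
move=> gM; apply/eqP; rewrite -leye_eq -(limf_einf_pinfty gM).
exact: limf_einf_le_esup.
Qed.

(** Each dimension is the infimum of a set [Q] of exponents; whether the threshold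
    [d] itself belongs to [Q] does not matter. *)
Lemma ereal_inf_threshold (R : realType) (Q : R -> Prop) (d : R) :
  (forall alpha, d < alpha -> Q alpha) ->
  (forall alpha, Q alpha -> d <= alpha) ->
  ereal_inf [set alpha%:E | alpha in [set alpha : R | Q alpha]] = d%:E.
Proof.
move=> up low; apply/eqP; rewrite eq_le; apply/andP; split.
  apply/lee_addgt0Pr => e e0; apply: ge_ereal_inf.
  by exists (d + e)%:E => //; exists (d + e) => //=; apply: up; rewrite ltrDl.
by apply: le_ereal_inf_tmp => _ [alpha /= /low da <-]; rewrite lee_fin.
Qed.

Lemma ereal_inf_none (R : realType) (Q : R -> Prop) :
  (forall alpha, ~ Q alpha) ->
  ereal_inf [set alpha%:E | alpha in [set alpha : R | Q alpha]] = +oo%E.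
Proof.
move=> nQ; apply: eq_infty => M; apply: le_ereal_inf_tmp => z [alpha /= Qa _].
by case: (nQ _ Qa).
Qed.

(** * From power bounds to the growth exponent *)

Lemma cvg_ln_growth (R : realType) (N : R -> nat) (d c H : R) :
  0 < c -> (forall A, H <= A -> c * A `^ d <= (N A)%:R) ->
  (forall eps, 0 < eps -> exists2 C, 0 < C &
    forall A, 1 <= A -> (N A)%:R <= C * A `^ (d + eps)) ->
  ln (N A)%:R / ln A @[A --> +oo] --> d.
Proof.
move=> c0 low up; apply/cvgrPdist_le => /= e e0.
have e20 : 0 < e / 2 by rewrite divr_gt0.
have [C C0 HC] := up _ e20.
near=> A.
have A1 : 1 < A by near: A; exact: nbhs_pinfty_gt (num_real _).
have A0 : 0 < A by lra.
have HA : H <= A by near: A; exact: nbhs_pinfty_ge (num_real _).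
have cA : expR (- ln c / e) <= A by near: A; exact: nbhs_pinfty_ge (num_real _).
have CA : expR (ln C / (e / 2)) <= A by near: A; exact: nbhs_pinfty_ge (num_real _).
have l0 : 0 < ln A by exact: ln_gt0.
have ln_ge x : expR x <= A -> x <= ln A.
  by move=> xA; rewrite -[leLHS]expRK ler_ln ?posrE ?expR_gt0.
move: cA CA => /ln_ge + /ln_ge; rewrite !ler_pdivrMr // => cA CA.
have lA := low _ HA; have uA := HC _ (ltW A1).
have N0 : (0 : R) < (N A)%:R by apply: lt_le_trans lA; rewrite mulr_gt0 ?powR_gt0.
move: lA; rewrite -ler_ln ?posrE ?mulr_gt0 ?powR_gt0 //.
rewrite lnM ?posrE ?powR_gt0 // ln_powR => lA.
move: uA; rewrite -ler_ln ?posrE ?mulr_gt0 ?powR_gt0 //.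
rewrite lnM ?posrE ?powR_gt0 // ln_powR => uA.
rewrite distrC ler_distl ler_pdivlMr // ler_pdivrMr //.
by apply/andP; split; lra.
Unshelve. all: by end_near.
Qed.

(** * Dimensions from point counts *)

Lemma card_in_ball_fin (R : realType) (K : set R) (x h : R) :
  finite_set (K `&` [set y | x - h <= y <= x + h]) ->
  card_in_ball K x h =
    (#|` fset_set (K `&` [set y | (x - h <= y <= x + h)%R])|%:R : R)%:E.
Proof. by move=> fin; rewrite /card_in_ball /counting asboolT. Qed.

Lemma card_in_ball_infinite (R : realType) (K : set R) (x h : R) :
  ~ finite_set (K `&` [set y | x - h <= y <= x + h]) ->
  card_in_ball K x h = +oo%E.
Proof. by move=> inf; rewrite /card_in_ball /counting asboolF. Qed.

Lemma has_mass_dim_infinite (R : realType) (K : set R) :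
  ~ locally_finite K -> has_mass_dim K +oo%E.
Proof.
move=> nlf.
have [c infK] : exists c : R, forall h, c <= h -> card_in_ball K 0 h = +oo%E.
  apply: contrapT => nc; apply: nlf => B [c [_ Bc]].
  apply: contrapT => infB; apply: nc; exists (c + 1) => h ch.
  apply: card_in_ball_infinite => fin; apply: infB.
  apply: sub_finite_set fin => y [Ky By]; split=> //=.
  rewrite sub0r add0r -ler_norml (le_trans _ ch) //.
  by apply: (Bc (c + 1)) => //; rewrite ltrDl.
have lowy alpha : lower_mass K alpha = +oo%E.
  apply: limf_einf_pinfty => M; exists (Num.max c 1) => h.
  rewrite ge_max => /andP[ch h1]; rewrite infK // gt0_mulye ?leey //.
  by rewrite lte_fin invr_gt0 powR_gt0 // (lt_le_trans ltr01).
have upy alpha : upper_mass K alpha = +oo%E.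
  apply/eqP; rewrite -leye_eq -(lowy alpha); exact: limf_einf_le_esup.
by split; apply: ereal_inf_none => alpha []; rewrite ?lowy ?upy ltxx.
Qed.

Lemma beurling_dim_infinite (R : realType) (K : set R) :
  ~ uniformly_locally_finite K -> beurling_dim K = +oo%E.
Proof.
move=> nulf.
have [rho [rho0 supK]] : exists rho : R, 0 < rho /\
    ereal_sup (range (fun x => card_in_ball K x rho)) = +oo%E.
  apply: contrapT => nrho; apply: nulf => rho rho0.
  rewrite ltey; apply/eqP => supK; apply: nrho; by exists rho.
have mono x h : rho <= h -> (card_in_ball K x rho <= card_in_ball K x h)%E.
  move=> rh; have sub : K `&` [set y | x - rho <= y <= x + rho] `<=`
      K `&` [set y | x - h <= y <= x + h].
    by move=> y [Ky /= yr]; split=> //=; lra.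
  have [fin|inf] := pselect (finite_set (K `&` [set y | x - h <= y <= x + h])).
    rewrite !card_in_ball_fin ?lee_fin ?ler_nat //.
      exact: card_fset_set_subset.
    exact: sub_finite_set fin.
  by rewrite [leRHS]card_in_ball_infinite // leey.
have infty alpha : upper_beurling_density K alpha = +oo%E.
  apply: limf_esup_pinfty => M; exists rho => h rh.
  have h0 : 0 < h `^ alpha by rewrite powR_gt0 // (lt_le_trans rho0).
  have : ((M * h `^ alpha)%:E < ereal_sup (range (fun x => card_in_ball K x rho)))%E.
    by rewrite supK ltry.
  move=> /ereal_sup_gt[_ [x _ <-]] Mx.
  apply: le_ereal_sup_tmp; exists (card_in_ball K x h * ((h `^ alpha)^-1)%:E)%E.
    by exists x.
  have -> : M = M * h `^ alpha * (h `^ alpha)^-1 by rewrite mulfK ?gt_eqF.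
  rewrite EFinM; apply: lee_wpmul2r; first by rewrite lee_fin invr_ge0 ltW.
  exact: le_trans (ltW Mx) (mono _ _ rh).
by apply: ereal_inf_none => alpha []; rewrite infty ltxx.
Qed.

Lemma card_density_le (R : realType) (K : set R) (x h alpha C : R) :
  0 < h -> finite_set (K `&` [set y | x - h <= y <= x + h]) ->
  #|` fset_set (K `&` [set y | (x - h <= y <= x + h)%R])|%:R
    <= C * h `^ alpha ->
  (card_in_ball K x h * ((h `^ alpha)^-1)%:E <= C%:E)%E.
Proof.
move=> h0 fin le; rewrite card_in_ball_fin // -EFinM lee_fin.
by rewrite ler_pdivrMr // powR_gt0.
Qed.

Lemma lower_mass_infinite (R : realType) (K : set R) (alpha eta c H : R) :
  locally_finite K -> 0 < eta -> 0 < c ->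
  (forall h, H <= h -> c * h `^ (alpha + eta) <=
    #|` fset_set (K `&` [set y | (0 - h <= y <= 0 + h)%R])|%:R) ->
  lower_mass K alpha = +oo%E.
Proof.
move=> lfK eta0 c0 low; apply: limf_einf_pinfty => M.
(* Beyond the third bound, [c * h `^ eta] is at least [M]. *)
exists (Num.max H (Num.max 1 ((Num.max 1 M / c) `^ eta^-1))) => h.
rewrite !ge_max => /and3P[Hh h1 Mh].
have h0 : 0 < h by lra.
rewrite card_in_ball_fin; last exact: locally_finite_ball.
rewrite -EFinM lee_fin ler_pdivlMr ?powR_gt0 //.
apply: le_trans (low _ Hh).
have -> : h `^ (alpha + eta) = h `^ alpha * h `^ eta.
  by rewrite powRD //; apply/implyP => _; rewrite gt_eqF.
rewrite mulrCA [leRHS]mulrC ler_wpM2r ?powR_ge0 //.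
have M1 : 0 < Num.max 1 M by rewrite lt_max ltr01.
have : Num.max 1 M / c <= h `^ eta.
  have -> : Num.max 1 M / c = ((Num.max 1 M / c) `^ eta^-1) `^ eta.
    by rewrite -powRrM mulVf ?gt_eqF // powRr1 // divr_ge0 // ltW.
  by rewrite ge0_ler_powR ?nnegrE ?powR_ge0 // ltW.
rewrite ler_pdivrMr // mulrC; apply: le_trans.
by rewrite le_max lexx orbT.
Qed.

Lemma uniformly_locally_finite_card (R : realType) (K : set R) (rho : R) :
  uniformly_locally_finite K -> 0 < rho ->
  exists M : nat, forall y,
    let D := K `&` [set z | y - rho <= z <= y + rho] in
    finite_set D /\ (#|` fset_set D| <= M)%N.
Proof.
move=> ulf rho0; have := ulf _ rho0; set s := ereal_sup _ => sy.
have les y : (card_in_ball K y rho <= s)%E.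
  by apply: le_ereal_sup_tmp; exists (card_in_ball K y rho) => //; exists y.
exists (Num.trunc (fine s)) => y D.
have fin : finite_set D.
  apply: contrapT => inf; have := les y.
  by rewrite card_in_ball_infinite // leye_eq => /eqP se; rewrite se ltxx in sy.
split=> //; have := les y; rewrite card_in_ball_fin //.
case: (s) sy => //= z _.
rewrite lee_fin => le; rewrite truncn_ge_nat //; exact: le_trans le.
Qed.

Lemma uniformly_locally_finiteW (R : realType) (K : set R) :
  uniformly_locally_finite K -> locally_finite K.
Proof.
move=> ulf B [c [_ Bc]].
have c1 : 0 < Num.max c 0 + 1 by rewrite ltr_wpDl // le_max lexx orbT.
have [M HM] := uniformly_locally_finite_card ulf c1.
apply: sub_finite_set (proj1 (HM 0)) => y [Ky By]; split=> //=.
rewrite sub0r add0r -ler_norml.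
by apply: (Bc (Num.max c 0 + 1)) => //; rewrite ltr_pwDr // le_max lexx.
Qed.

(** An interval of length [2 * h] is covered by about [h] intervals of length
    two. *)
Lemma card_ball_linear (R : realType) (K : set R) (M : nat) (x h : R) :
  (forall y, let D := K `&` [set z | y - 1 <= z <= y + 1] in
    finite_set D /\ (#|` fset_set D| <= M)%N) -> 1 <= h ->
  #|` fset_set (K `&` [set y | (x - h <= y <= x + h)%R])|%:R
    <= 2 * M%:R * h.
Proof.
move=> unif h1.
pose n := (Num.trunc h).+1.
pose center k := x - h + 1 + 2 * k%:R.
pose Y k := K `&` [set z | center k - 1 <= z <= center k + 1].
have [|k _|z [Kz /= zI]|_] := @card_fset_set_cover nat R `I_n Y
  (K `&` [set y | x - h <= y <= x + h]) M.
- exact: finite_II.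
- exact: unif.
- have q0 : 0 <= (z - (x - h)) / 2 by lra.
  have /andP[k1 k2] := truncn_itv q0.
  exists (Num.trunc ((z - (x - h)) / 2)).
    by rewrite /= ltnS le_truncn //; lra.
  by split=> //=; rewrite /center; move: k2; rewrite -[(Num.trunc _).+1%:R]natr1; lra.
have -> : (#|` fset_set `I_n| = n)%N.
  by rewrite fset_set_II (card_imfset _ _ val_inj) -cardE card_ord.
move=> le.
have nh : n%:R <= 2 * h.
  rewrite /n -[(Num.trunc _).+1%:R]natr1.
  have /andP[t1 _] := truncn_itv (le_trans ler01 h1); lra.
apply: (@le_trans _ _ (n * M)%:R); first by rewrite ler_nat.
rewrite natrM mulrAC ler_wpM2r //.
Qed.

(** * The dimensions of an invariant set *)

Lemma exists_expansion_bounds (R : realType) (m : nat) (r b : 'I_m -> R) :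
  (forall i, 1 < `|r i|) ->
  exists lam rho beta : R, [/\ 1 < lam, forall i, lam <= `|r i|, 1 <= rho,
    forall i, `|r i| <= rho & 1 <= beta /\
    forall i, `|b i| <= beta * (`|r i| - 1)].
Proof.
move=> hr.
have sum_ge (F : 'I_m -> R) i : (forall j, 0 <= F j) -> F i <= 1 + \sum_j F j.
  by move=> F0; rewrite (bigD1 i) //= addrCA lerDl addr_ge0 // sumr_ge0.
have sum_ge1 (F : 'I_m -> R) : (forall j, 0 <= F j) -> 1 <= 1 + \sum_j F j.
  by move=> F0; rewrite lerDl sumr_ge0.
have q0 i : 0 <= `|b i| / (`|r i| - 1).
  by rewrite divr_ge0 // subr_ge0 ltW.
exists (\big[Num.min/2]_i `|r i|), (1 + \sum_i `|r i|).
exists (1 + \sum_i (`|b i| / (`|r i| - 1))); split.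
- by apply: lt_bigmin => //; rewrite ltr1n.
- by move=> i; exact: bigmin_le_cond.
- exact: sum_ge1.
- by move=> i; apply: (sum_ge (fun i => `|r i|)).
split; first exact: sum_ge1.
move=> i; rewrite -ler_pdivrMr ?subr_gt0 //.
exact: (sum_ge (fun i => `|b i| / (`|r i| - 1))).
Qed.

Theorem corollary4p2 (R : realType) (m : nat) (r b : 'I_m -> R)
    (f : 'I_m -> R -> R) (hf : forall i, f i = affmap (r i) (b i))
    (hr : forall i, 1 < `|r i|) (hdistinct : injective f)
    (K : set R) (hK : invariant_set f K) :
  (locally_finite K -> has_mass_dim K (growth_exponent f)%:E) /\
  (~ locally_finite K -> has_mass_dim K +oo%E) /\
  (uniformly_locally_finite K ->
    beurling_dim K = (growth_exponent f)%:E /\ growth_exponent f <= 1) /\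
  (~ uniformly_locally_finite K -> beurling_dim K = +oo%E).
Proof.
have [lam [rho [beta [lam1 lamr rho1 rrho [beta1 bbeta]]]]] :=
  exists_expansion_bounds b hr.
(* Only the identity separates [word_count] from [semigroup_count], so [d] is the
   growth exponent. *)
have [d d0 [low up]] := word_maps_growth (f := f) lam1 lamr rho1 rrho.
have [[x0 Kx0] KE] := hK.
have [i0 _ _] : (\bigcup_(i in [set: 'I_m]) (f i @` K)) x0 by rewrite -KE.
have rho0 : 0 < rho by lra.
have -> : growth_exponent f = d.
  apply/cvg_lim => //.
  apply: (@cvg_ln_growth _ (semigroup_count f) d ((rho^-1 `^ d) / 2) (rho + 1)).
  - by rewrite divr_gt0 // powR_gt0 // invr_gt0.
  - move=> A HA; have A0 : 0 < A by lra.
    have rA : rho < A by lra.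
    have AV : (A / rho) `^ d = A `^ d * rho^-1 `^ d.
      by rewrite powRM ?invr_ge0 // ltW.
    have lA := low _ rA; rewrite AV in lA.
    have := word_count_le hf lam1 lamr rrho i0 (ltW rA).
    by rewrite -(ler_nat R) natrM; lra.
  - move=> eps eps0; have [C C0 HC] := up _ eps0; exists C => // A A1.
    apply: le_trans (HC _ A1); rewrite ler_nat.
    exact: (semigroup_count_le hf lam1 lamr A).
have up' alpha : d < alpha -> exists2 C, 0 < C &
    forall A, 1 <= A -> (word_count r f A)%:R <= C * A `^ alpha.
  by move=> da; have [|C C0] := up (alpha - d); rewrite ?subr_gt0 // subrKC; exists C.
have lowy alpha : locally_finite K -> alpha < d -> lower_mass K alpha = +oo%E.
  (* Half of the gap pays for the number of slopes, half for the divergence. *)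
  move=> lfK ad; pose eta := (d - alpha) / 2.
  have eta0 : 0 < eta by rewrite divr_gt0 // subr_gt0.
  have [c [H [c0 cH]]] := card_centered_ball_lower hf lam1 lamr rho1 bbeta beta1
    hK lfK eta0 low.
  apply: (lower_mass_infinite (H := H) lfK eta0 c0) => h Hh.
  have -> : alpha + eta = d - eta by rewrite /eta; field.
  exact: cH.
have low_upper alpha : (lower_mass K alpha <= upper_mass K alpha)%E.
  exact: limf_einf_le_esup.
have upper_beurling alpha :
    (upper_mass K alpha <= upper_beurling_density K alpha)%E.
  rewrite /upper_mass /upper_beurling_density !limf_esupE.
  apply: le_ereal_inf_tmp => _ [V FV <-].
  apply: ge_ereal_inf; exists (ereal_sup ((fun h : R =>
    (card_in_ball K 0 h * ((h `^ alpha)^-1)%:E)%E) @` V)); first by exists V.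
  apply: ge_ereal_sup => _ [h Vh <-].
  apply: le_ereal_sup_tmp; eexists; first by exists h.
  by apply: le_ereal_sup_tmp; eexists; first by exists 0.
have ge_d alpha : locally_finite K -> (lower_mass K alpha < +oo)%E -> d <= alpha.
  by move=> lfK; rewrite leNgt; apply: contraTN => /(lowy _ lfK) ->; rewrite ltxx.
have mass_fin alpha : locally_finite K -> d < alpha ->
    (upper_mass K alpha < +oo)%E.
  move=> lfK /up'[C C0 HC].
  have finE : finite_set (K `&` [set y | `|y| <= beta + 1]).
    apply: sub_finite_set (locally_finite_ball 0 (beta + 1) lfK) => y [Ky /= yb].
    by split=> //=; rewrite sub0r add0r -ler_norml.
  have [C' _ HC'] := word_count_scaled_le rho1
    #|` fset_set (K `&` [set y | (`|y| <= beta + 1)%R])| HC C0.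
  apply: (@limf_esup_pinfty_lt _ _ C' 1) => h h1.
  have [fin card] := card_centered_ball_le hf lam1 lamr rrho bbeta beta1 KE h1 finE.
  apply: card_density_le => //; first lra.
  by apply: le_trans (HC' _ h1); rewrite ler_nat.
split=> [lfK|].
  split; apply: ereal_inf_threshold => alpha.
  - by move=> da; split; [lra|exact: mass_fin].
  - by move=> [_ ua]; apply: ge_d lfK _; exact: le_lt_trans (low_upper _) ua.
  - move=> da; split; first lra.
    exact: le_lt_trans (low_upper _) (mass_fin _ lfK da).
  - by move=> [_ la]; exact: ge_d.
split; first exact: has_mass_dim_infinite.
split; last exact: beurling_dim_infinite.
move=> ulf; have lfK := uniformly_locally_finiteW ulf.
have [M HM] := uniformly_locally_finite_card ulf ltr01.
split.
  apply: ereal_inf_threshold => alpha; last first.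
    move=> [_ ba]; apply: ge_d lfK _.
    exact: le_lt_trans (low_upper _) (le_lt_trans (upper_beurling _) ba).
  move=> da; split; first lra.
  have [C C0 HC] := up' _ da.
  have [C' _ HC'] := word_count_scaled_le rho1 M HC C0.
  apply: (@limf_esup_pinfty_lt _ _ C' 1) => h h1.
  apply: ge_ereal_sup => _ [x _ <-].
  have [fin card] := card_uniform_ball_le hf lam1 lamr rrho x KE h1 HM.
  apply: card_density_le => //; first lra.
  by apply: le_trans (HC' _ h1); rewrite ler_nat.
apply: (ge_d _ lfK); apply: le_lt_trans (low_upper _) _.
apply: (@limf_esup_pinfty_lt _ _ (2 * M%:R) 1) => h h1.
have h0 : 0 < h by lra.
apply: (card_density_le h0 (locally_finite_ball 0 h lfK)).
by rewrite (powRr1 (ltW h0)); exact: (card_ball_linear _ HM h1).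
Qed.
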